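(* Let $p$ be a prime and let $\mathcal{R}_p$ be the set of quadratic residues in $\mathbb{F}_p$. Assume that $\mathcal{A},\mathcal{B}\subseteq\mathbb{F}_p$ satisfy $|\mathcal{A}|,|\mathcal{B}|\geqslant 2$ and $\mathcal{A}+\mathcal{B}=\mathcal{R}_p$. Then \[\mathfrak{A}(\mathcal{A},\mathcal{B})\geqslant (\log 2)^{-1}\sqrt{p}-1.6.\]
   Context: $\mathcal{R}_p=\{x^2:x\in\mathbb{F}_p^\times\}$. For $\mathcal{A},\mathcal{B}\subseteq\mathbb{F}_p$, $\mathcal{A}+\mathcal{B}=\{a+b:a\in\mathcal{A},b\in\mathcal{B}\}$, the representation function is $r(x)=|\{(a,b)\in\mathcal{A}\times\mathcal{B}:a+b=x\}|$, and $\mathfrak{A}(\mathcal{A},\mathcal{B})=|\{x\in\mathcal{A}+\mathcal{B}: r(x)=1\}|$ is the number of elements of $\mathcal{A}+\mathcal{B}$ with a unique representation. *)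

(* Defs.v *)
From HB Require Import structures.
From mathcomp Require Export all_boot all_order all_algebra.
From mathcomp Require Export reals exp.

Set Implicit Arguments.
Unset Strict Implicit.
Unset Printing Implicit Defensive.

Import Order.TTheory GRing.Theory Num.Theory.
Local Open Scope ring_scope.

(* For composite p, 'F_p is the prime field of the smallest prime factor of p. *)
Definition quad_residues (p : nat) : {set 'F_p} :=
  [set x ^+ 2 | x : 'F_p & x != 0].

Definition sumset (V : finZmodType) (A B : {set V}) : {set V} :=
  [set a + b | a in A, b in B].

Definition rep_count (V : finZmodType) (A B : {set V}) (x : V) : nat :=
  #|[set ab in setX A B | ab.1 + ab.2 == x]|.

Definition unique_rep_count (V : finZmodType) (A B : {set V}) : nat :=
  #|[set x in sumset A B | rep_count A B x == 1%N]|.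

(* Main.v *)
(** If [A + B] consists of quadratic residues, the Stepanov method of Hanson and
    Petridis gives [|A| |B| <= (p-1)/2]. When [A + B] is all of the residues this
    forces [|A| |B| = |A + B|], so every one of the [(p-1)/2] residues has exactly
    one representation, which is at least the required [sqrt p / ln 2 - 1.6]. *)
Require Import Defs.
From mathcomp Require Import all_boot all_order all_algebra.
From mathcomp Require Import reals exp.
From mathcomp Require Import finfield ring lra zify.
Import Order.TTheory GRing.Theory Num.Theory.
Local Open Scope ring_scope.

(** The Vandermonde matrix of distinct nodes is invertible, and [c] is the last column of its
    inverse. These are the divided-difference weights: [c] extracts the coefficient of degree [n] of
    a polynomial of degree at most [n] from its values at the nodes. *)
Lemma exists_dual_weights (F : fieldType) (n : nat) (a : 'I_n.+1 -> F) :
  injective a ->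
  exists c : 'I_n.+1 -> F,
    forall k, (k <= n)%N -> \sum_i c i * a i ^+ k = (k == n)%:R.
Proof.
move=> a_inj; pose V := Vandermonde n.+1 (\row_i a i).
have V_unit : V \in unitmx.
  rewrite unitmxE det_Vandermonde unitfE prodf_seq_neq0; apply/allP => i _ /=.
  rewrite prodf_seq_neq0; apply/allP => j _; apply/implyP => lt_ij.
  rewrite !mxE subr_eq0; apply: contraTneq lt_ij => /a_inj ->.
  by rewrite ltnn.
pose c := invmx V *m (delta_mx ord_max 0 : 'cV_n.+1).
exists (fun i => c i 0) => k le_kn.
have /matrixP/(_ (inord k) 0) : V *m c = delta_mx ord_max 0 by rewrite mulKVmx.
rewrite !mxE eqxx andbT -val_eqE /= inordK // => <-.
by apply: eq_bigr => i _; rewrite !mxE inordK // mulrC.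
Qed.

(** Translating the variable does not change the coefficient of degree [n] of a polynomial of degree
    at most [n], so the weights serve every translate of the nodes. *)
Lemma dual_weights_shift (F : fieldType) (n : nat) (a c : 'I_n.+1 -> F) :
  (forall k, (k <= n)%N -> \sum_i c i * a i ^+ k = (k == n)%:R) ->
  forall b k, (k <= n)%N -> \sum_i c i * (b + a i) ^+ k = (k == n)%:R.
Proof.
move=> c_dual b k le_kn.
under eq_bigr do rewrite exprDn mulr_sumr.
rewrite exchange_big /= big_ord_recr /= big1 => [|j _].
  by rewrite add0r subnn binn; under eq_bigr do rewrite mul1r; apply: c_dual.
under eq_bigr do rewrite mulrnAr mulrCA.
rewrite sumrMnl -mulr_sumr c_dual; last by have := ltn_ord j; lia.
by rewrite (_ : (j == n :> nat) = false) ?mulr0 ?mul0rn //; have := ltn_ord j; lia.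
Qed.

(** Binomial expansion around [b]. Taking [b = 0] gives the ordinary coefficients; another [b]
    displays the order of vanishing there. *)
Lemma weighted_powers_taylor (F : fieldType) (n N : nat) (a c : 'I_n -> F) b :
  \sum_i c i *: ('X + (a i)%:P) ^+ N =
  \sum_(j < N.+1)
     ((\sum_i c i * (b + a i) ^+ (N - j)) *+ 'C(N, j)) *: ('X - b%:P) ^+ j.
Proof.
under [RHS]eq_bigr do rewrite -scalerMnl scaler_suml -sumrMnl.
rewrite [RHS]exchange_big /=; apply: eq_bigr => i _.
have -> : 'X + (a i)%:P = (b + a i)%:P + ('X - b%:P).
  by rewrite polyCD; ring.
rewrite exprDn scaler_sumr; apply: eq_bigr => j _.
by rewrite -rmorphXn mul_polyC -scalerMnr scalerA.
Qed.

Lemma dvdp_prod_exp_XsubC (F : fieldType) (n : nat) (s : seq F) (q : {poly F}) :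
  uniq s -> {in s, forall b, ('X - b%:P) ^+ n %| q} ->
  \prod_(b <- s) ('X - b%:P) ^+ n %| q.
Proof.
elim: s => [|b s IHs] /=; first by rewrite big_nil dvd1p.
case/andP=> bNs s_uniq dvd_q; rewrite big_cons Gauss_dvdp; last first.
  rewrite prodrXl coprimep_expl // coprimep_expr // coprimep_sym.
  by rewrite coprimep_XsubC root_prod_XsubC.
rewrite dvd_q ?mem_head //= IHs // => x x_s.
by apply: dvd_q; rewrite inE x_s orbT.
Qed.

(* The weights [c] make [q] vanish to order [size A] at every point of [B] and
   cancel its coefficients above degree [m]; the binomial hypothesis keeps the
   coefficient of degree [m] nonzero. *)
Lemma stepanov_bound (F : fieldType) (A B : seq F) (m : nat) :
  (0 < m)%N -> uniq A -> uniq B ->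
  {in A & B, forall a b, (a + b) ^+ m = 1} ->
  ('C((size A).-1 + m, m))%:R != 0 :> F ->
  (size A * size B <= m)%N.
Proof.
move=> m_gt0 A_uniq B_uniq AB1.
case En: (size A) => [|n] //= C_neq0; pose a (i : 'I_n.+1) := A`_i.
have a_inj : injective a.
  by move=> i j /eqP; rewrite nth_uniq ?En // => /eqP/val_inj.
have [c c_dual] := exists_dual_weights _ _ _ a_inj.
set N := (n + m)%N in C_neq0.
pose q := \sum_i c i *: ('X + (a i)%:P) ^+ N - 1.
have q_coef k : q`_k = (if (k <= N)%N
    then (\sum_i c i * a i ^+ (N - k)) *+ 'C(N, k) else 0) - (k == 0)%:R.
  rewrite coefB coef1; congr (_ - _).
  rewrite (weighted_powers_taylor _ _ _ _ _ 0) subr0.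
  under eq_bigr do under eq_bigr do rewrite add0r.
  rewrite -(poly_def _ (fun j => (\sum_i c i * a i ^+ (N - j)) *+ 'C(N, j))).
  by rewrite coef_poly ltnS.
have qm : q`_m != 0.
  rewrite q_coef leq_addl addnK c_dual // eqxx.
  by rewrite (_ : (m == 0)%N = false) ?subr0 //; lia.
have q_neq0 : q != 0 by apply: contraNneq qm => ->; rewrite coef0.
have size_q : (size q <= m.+1)%N.
  apply/leq_sizeP => k lt_mk; rewrite q_coef.
  rewrite (_ : (k == 0)%N = false) ?subr0; last by lia.
  case: leqP => // le_kN; rewrite c_dual; last by lia.
  by rewrite (_ : (_ == n) = false) ?mul0rn //; lia.
have q_dvd : {in B, forall b, ('X - b%:P) ^+ n.+1 %| q}.
  move=> b b_B; rewrite /q (weighted_powers_taylor _ _ _ _ _ b).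
  have low_coef j : (j <= n)%N ->
      \sum_i c i * (b + a i) ^+ (N - j) = (j == 0)%:R.
    (* Each [b + a i] is an [m]-th root of unity, so the exponent [N - j = (n - j) + m] drops to
       [n - j], within the range of the dual weights. *)
    move=> le_jn; transitivity (\sum_i c i * (b + a i) ^+ (n - j)).
      apply: eq_bigr => i _; congr (_ * _).
      rewrite /N -addnBAC // exprD addrC AB1 ?mulr1 //.
      by rewrite mem_nth // En.
    rewrite dual_weights_shift //; last by lia.
    by congr (nat_of_bool _)%:R; lia.
  (* The constant Taylor term is 1 and cancels the [- 1] in [q]; those of degrees 1 to [n] vanish,
     and the rest are multiples of [('X - b%:P) ^+ n.+1]. *)
  rewrite big_ord_recl /= low_coef // bin0 mulr1n scale1r expr0 addrAC subrr add0r.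
  elim/big_ind: _ => [|u v|j _]; [exact: dvdp0 | exact: dvdp_add|].
  rewrite /bump /= add1n.
  have [lt_jn|le_nj] := ltnP j n.
    by rewrite low_coef // mul0rn scale0r dvdp0.
  by rewrite -mul_polyC dvdp_mull // dvdp_exp2l.
(* Degree count: a product of degree [size B * n.+1] divides the nonzero [q], whose degree is at
   most [m]. *)
have := dvdp_leq q_neq0 (dvdp_prod_exp_XsubC _ _ _ _ B_uniq q_dvd).
rewrite prodrXl => /leq_trans/(_ size_q).
set P := \prod_(b <- B) _; have P_neq0 : P ^+ n.+1 != 0.
  by rewrite expf_neq0 // monic_neq0 // monic_prod_XsubC.
move: P_neq0; rewrite -size_poly_gt0 => /prednK <-.
by rewrite size_exp size_prod_XsubC ltnS mulnC.
Qed.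

Lemma quad_residue_exp (p : nat) (x : 'F_p) :
  prime p -> odd p -> x \in quad_residues p -> x ^+ (p.-1)./2 = 1.
Proof.
move=> p_pr p_odd /imsetP[y]; rewrite inE => y_neq0 ->.
rewrite -exprM mul2n halfK (_ : odd p.-1 = false); last first.
  by have := prime_gt0 p_pr; lia.
apply: (mulfI y_neq0); rewrite mulr1 subn0 -exprS prednK ?prime_gt0 //.
by rewrite -[X in y ^+ X](card_Fp p_pr) expf_card.
Qed.

(** Each fibre of squaring on the nonzero elements lies in some [[set x; - x]], hence has at most
    two elements. *)
Lemma half_le_card_quad_residues (p : nat) :
  prime p -> ((p.-1)./2 <= #|quad_residues p|)%N.
Proof.
move=> p_pr; suff : (p.-1 <= #|quad_residues p| * 2)%N by lia.
rewrite -[X in (X.-1 <= _)%N](card_Fp p_pr) -(cardC1 (0 : 'F_p)).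
rewrite -[X in (X <= _)%N]sum1_card (partition_big_imset (fun x => x ^+ 2)) /=.
rewrite (_ : [set x ^+ 2 | x in predC1 0] = quad_residues p); last first.
  by apply/setP => y; apply/imsetP/imsetP => -[x];
    rewrite ?inE => x_neq0 ->; exists x; rewrite ?inE.
rewrite -sum_nat_const; apply: leq_sum => y /imsetP[x _ ->].
rewrite sum1dep_card (@leq_trans #|[set x; - x]|) //; last first.
  by rewrite cards2 ltnS leq_b1.
apply/subset_leq_card/subsetP => z; rewrite !inE => /andP[_].
by rewrite eqf_sqr.
Qed.

Lemma card_mul_sumset_sub_quad_residues (p : nat) (A B : {set 'F_p}) :
  prime p -> odd p -> sumset A B \subset quad_residues p ->
  (#|A| * #|B| <= (p.-1)./2)%N.
Proof.
move=> p_pr p_odd AB_sub; set m := (p.-1)./2.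
have p_gt1 := prime_gt1 p_pr.
have m_gt0 : (0 < m)%N by rewrite /m; lia.
have AB1 : {in A & B, forall a b, (a + b) ^+ m = 1}.
  move=> a b a_A b_B; apply: quad_residue_exp => //.
  by apply: (subsetP AB_sub); apply: imset2_f.
have [->|[b b_B]] := set_0Vmem B; first by rewrite cards0 muln0.
(* The translate of [A] by [b] consists of [m]-th roots of unity. This preliminary bound keeps [N]
   below at most [2m = p - 1], so that [p] cannot divide the binomial coefficient. *)
have le_Am : (#|A| <= m)%N.
  have inj_b : injective (fun a => a + b) by exact: addIr.
  rewrite -(card_imset _ inj_b) cardE max_unity_roots ?enum_uniq //.
  apply/allP => y; rewrite mem_enum => /imsetP[a a_A ->].
  by apply/unity_rootP; apply: AB1.
rewrite !cardE; apply: (@stepanov_bound 'F_p); rewrite ?enum_uniq //.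
  by move=> a b'; rewrite !mem_enum; apply: AB1.
rewrite -(dvdn_pcharf (pchar_Fp p_pr)) -cardE.
apply/negP => p_dvd; set N := (_ + m)%N in p_dvd.
have : (p %| N`!)%N.
  by rewrite -(@bin_fact N m) ?leq_addl // dvdn_mulr.
have : (N < p)%N.
  apply: (@leq_ltn_trans (m + m)); last by rewrite /m; lia.
  by rewrite leq_add2r (leq_trans (leq_pred _)).
elim: (N) => [|k IHk] lt_kp; first by rewrite dvdn1; lia.
by rewrite factS Euclid_dvdM // gtnNdvd //= => /IHk; apply; apply: ltnW.
Qed.

Lemma sumsetE (V : finZmodType) (A B : {set V}) :
  sumset A B = [set ab.1 + ab.2 | ab in setX A B].
Proof. by rewrite /sumset curry_imset2X; apply: eq_imset => -[]. Qed.

Lemma card_sumset_leq (V : finZmodType) (A B : {set V}) :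
  (#|sumset A B| <= #|A| * #|B|)%N.
Proof. by rewrite sumsetE -cardsX leq_imset_card. Qed.

(** Addition maps [setX A B] onto the sumset; equal cardinalities make it injective, so every fibre
    is a singleton. *)
Lemma unique_rep_count_full (V : finZmodType) (A B : {set V}) :
  #|sumset A B| = (#|A| * #|B|)%N -> unique_rep_count A B = #|sumset A B|.
Proof.
move=> card_AB.
have f_inj : {in setX A B &, injective (fun ab : V * V => ab.1 + ab.2)}.
  by apply/imset_injP; rewrite -sumsetE card_AB cardsX.
apply: eq_card => x; rewrite !inE; apply: andb_idr.
rewrite sumsetE => /imsetP[ab ab_AB ->]; apply/cards1P; exists ab.
apply/setP => cd; rewrite in_set1 in_set.
apply/andP/eqP => [[cd_AB /eqP]|->]; last by rewrite ab_AB eqxx.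
exact: f_inj.
Qed.

(** Here [m] stands for [(p - 1) / 2]. The crude estimate [1 / ln 2 <= 2] suffices, and 6 is the
    least [m] with [2 * sqrt (2m + 1) - 1.6 <= m]. *)
Lemma unique_rep_bound (R : realType) (m : nat) : (6 <= m)%N ->
  (ln (2 : R))^-1 * Num.sqrt ((m.*2.+1)%:R : R) - 16 / 10 <= m%:R.
Proof.
move=> m_ge6; set s := Num.sqrt _.
have s_ge0 : 0 <= s by exact: sqrtr_ge0.
have s_sqr : s ^+ 2 = 2 * m%:R + 1.
  by rewrite sqr_sqrtr ?ler0n // -addn1 natrD -mul2n natrM.
(* This is [ln (1 + x) <= x] at [x = - 1/2]. *)
have ln2_ge : 2^-1 <= ln (2 : R).
  have : ln (1 - 2^-1 : R) <= - 2^-1 by apply: le_ln1Dx; lra.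
  rewrite (_ : 1 - 2^-1 = 2^-1 :> R); last by lra.
  by rewrite lnV ?posrE // lerN2.
have inv_le : (ln (2 : R))^-1 <= 2.
  rewrite -[leRHS]invrK lef_pV2 ?posrE //; lra.
have m_geR : 6 <= m%:R :> R by rewrite (ler_nat R 6).
have : (ln (2 : R))^-1 * s <= 2 * s by rewrite ler_wpM2r.
suff : 2 * s - 16 / 10 <= m%:R by lra.
nra.
Qed.

Theorem theorem1p2 (R : realType) (p : nat) (hp : prime p)
    (A B : {set 'F_p}) (hA : (2 <= #|A|)%N) (hB : (2 <= #|B|)%N)
    (hAB : sumset A B = quad_residues p) :
  (ln (2 : R))^-1 * Num.sqrt (p%:R : R) - 16 / 10
    <= (unique_rep_count A B)%:R.
Proof.
(* If [p = 2], both sets are the whole field, so their sumset contains 0, which is not a nonzero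
   square. *)
have p_odd : odd p.
  case: (even_prime hp) => // p2; have /negP[] : 0 \notin sumset A B.
    rewrite hAB; apply/imsetP => -[x]; rewrite inE => x_neq0 /esym/eqP.
    by rewrite expf_eq0 /= (negPf x_neq0).
  have full (C : {set 'F_p}) : (2 <= #|C|)%N -> C = [set: 'F_p].
    by move=> hC; apply/eqP; rewrite eqEcard subsetT cardsT card_Fp //; lia.
  by apply/imset2P; exists 0 0; rewrite ?addr0 // ?(full A hA) ?(full B hB) inE.
have mul_le : (#|A| * #|B| <= (p.-1)./2)%N.
  by rewrite card_mul_sumset_sub_quad_residues ?hAB.
have card_ge : ((p.-1)./2 <= #|sumset A B|)%N.
  by rewrite hAB half_le_card_quad_residues.
have card_le := card_sumset_leq _ A B.
have mul_AB : (#|A| * #|B| = (p.-1)./2)%N.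
  by apply/eqP; rewrite eqn_leq mul_le (leq_trans card_ge card_le).
have card_AB : #|sumset A B| = (p.-1)./2.
  by apply/eqP; rewrite eqn_leq card_ge -mul_AB card_le.
rewrite (unique_rep_count_full _ A B) ?card_AB ?mul_AB //.
have pE : p = ((p.-1)./2).*2.+1 by lia.
have m_ge6 : (6 <= (p.-1)./2)%N.
  (* The only product below [6] of two factors [>= 2] is [4], giving [p = 9]. *)
  rewrite -mul_AB; case: leqP => // AB_lt6.
  have AB4 : (#|A| * #|B| = 4)%N.
    move: hA hB AB_lt6; move: #|A| #|B| => a b a_ge2 b_ge2 ab_lt6.
    have [a_le2 b_le2] : (a <= 2)%N /\ (b <= 2)%N by split; nia.
    by have [-> ->] : a = 2%N /\ b = 2%N by lia.
  by move: hp; rewrite pE -mul_AB AB4.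
by have := unique_rep_bound R _ m_ge6; rewrite -pE.
Qed.
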